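(* Let $0 < \alpha < 1$ and $-\infty < \beta < \infty$. Let $X, X_1, X_2, \ldots$ be independent identically distributed real-valued random variables and $S_n = X_1 + \cdots + X_n$, $n \ge 1$. Then $$\limsup_{n \rightarrow \infty} \left| \frac{S_{n}}{n^{1/\alpha}} \right|^{(\log \log n)^{-1}} = e^{\beta} \quad \text{almost surely}$$ if and only if $$\inf \left\{b \in \mathbb{R}:~ \mathbb{E} \left(\frac{|X|^{\alpha}}{(L|X|)^{b\alpha}} \right) < \infty \right\} = \beta.$$
   Context: $\log$ is the natural logarithm and $Lx = \log(\max(e, x))$ for $x \ge 0$. The quantity $|\cdot|^{(\log\log n)^{-1}}$ is considered for $n \ge 3$. The infimum is taken in the extended reals over real $b$, with the infimum of the empty set equal to $+\infty$. *)

(* Defs.v *)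
From HB Require Import structures.
From mathcomp Require Export all_boot all_order all_algebra finmap.
From mathcomp Require Export all_classical all_reals all_analysis.
Set Implicit Arguments.
Unset Strict Implicit.
Unset Printing Implicit Defensive.
Import Order.TTheory GRing.Theory Num.Theory.
Import numFieldNormedType.Exports.

Local Open Scope classical_set_scope.
Local Open Scope ring_scope.

Definition independent_RVs (d : measure_display) (T : measurableType d)
    (R : realType) (P : probability T R) (X : nat -> {RV P >-> R}) : Prop :=
  forall (J : {fset nat}) (A : nat -> set R),
    (forall i, measurable (A i)) ->
    P (\bigcap_(i in [set` J]) (X i @^-1` A i)) =
    (\prod_(i <- J) P (X i @^-1` A i))%E.

Definition identically_distributed (d : measure_display)
    (T : measurableType d) (R : realType) (P : probability T R)
    (X : nat -> {RV P >-> R}) : Prop :=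
  forall (i j : nat) (A : set R), measurable A ->
    distribution P (X i) A = distribution P (X j) A.

Definition iid (d : measure_display) (T : measurableType d) (R : realType)
    (P : probability T R) (X : nat -> {RV P >-> R}) : Prop :=
  independent_RVs X /\ identically_distributed X.

Definition logL (R : realType) (x : R) : R := ln (Num.max (expR 1) x).

(* The sum starts at 1: [X 0] is the generic copy of the common law. *)
Definition partial_sum (d : measure_display) (T : measurableType d)
    (R : realType) (P : probability T R) (X : nat -> {RV P >-> R})
    (n : nat) (w : T) : R :=
  \sum_(1 <= i < n.+1) X i w.

(* Main.v *)
Require Import Defs.
From mathcomp Require Import all_boot all_order all_algebra finmap.
From mathcomp Require Import all_classical all_reals all_analysis.
From mathcomp Require Import measurable_realfun ring lra zify.
Import Order.TTheory GRing.Theory Num.Theory.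
Import numFieldNormedType.Exports.
Local Open Scope classical_set_scope.
Local Open Scope ring_scope.
Set Implicit Arguments.
Unset Strict Implicit.
Unset Printing Implicit Defensive.

(** Write phi_b(x) = x^alpha / (L x)^(b alpha).  Up to constant factors, phi_b is the
    inverse of n |-> c_n(b) = n^(1/alpha) (log n)^b, so that E phi_b(|X|) < +oo is
    equivalent to sum_n P(|X| >= c_n(b)) < +oo.  For every real b there is a dichotomy.

    If E phi_b(|X|) < +oo then |S_n| = O(c_n(b)) almost surely
    ([partial_sum_upper_growth]).  Since alpha < 1, the norming constants grow faster
    than n by a power of n, so sum_n min(x / c_n(b), 1) is still of the order of phi_b(x)
    ([sum_min_le]).  Integrating, sum_n |X_n| / c_n(b) is almost surely finite, and
    bounding |S_n| by |X_1| + ... + |X_n| loses nothing: no centering is required.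

    If E phi_b(|X|) = +oo then |S_n| >= c c_n(b) infinitely often, almost surely and for
    some c > 0 ([partial_sum_lower_growth]): by independence |X_n| >= c_n(b) infinitely
    often ([second_borel_cantelli]), and X_n is the difference of two partial sums.

    The root of order log log n sends c_n(b) / n^(1/alpha) = (log n)^b to e^b and any
    constant factor to 1.  Hence the limit superior is almost surely at most e^b for
    every b with a finite moment, and at least e^b for every b with an infinite one.
    It is equal to e^beta almost surely if and only if beta separates these two sets
    of b, that is, if and only if beta is the infimum of the first one. *)

(** * Elementary estimates for logarithms and powers *)

(** Arbitrarily small slope: this is the form in which ln x = o(x) is used. *)
Lemma ln_le_affine (R : realType) (e x : R) :
  0 < e -> 0 < x -> ln x <= e * x - ln e.
Proof.
move=> e0 x0; have := ltW (ln_sublinear (mulr_gt0 e0 x0)).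
by rewrite lnM ?posrE//; lra.
Qed.

(** If u and v differ by a factor at most C then so do their p-th powers up to
    C^|p|, whatever the sign of p.  This is what allows b to have any sign below
    without a case analysis at every estimate. *)
Lemma powR_le_comparable (R : realType) (C u v p : R) :
  0 < u -> 0 < v -> u <= C * v -> v <= C * u -> u `^ p <= C `^ `|p| * v `^ p.
Proof.
move=> u0 v0 uv vu.
have C0 : 0 < C by rewrite -(pmulr_lgt0 _ v0); exact: lt_le_trans uv.
have [p0|p0] := leP 0 p.
  by rewrite ger0_norm// -powRM ?(ltW C0) ?(ltW v0)// ge0_ler_powR// nnegrE ltW// mulr_gt0.
rewrite ltr0_norm//.
have : v `^ (- p) <= (C * u) `^ (- p).
  by rewrite ge0_ler_powR ?oppr_ge0 ?(ltW p0)// nnegrE ltW// mulr_gt0.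
rewrite powRM ?(ltW C0) ?(ltW u0)// (powRN v p) (powRN u p).
by rewrite ler_pdivlMr ?powR_gt0// mulrC ler_pdivrMr ?powR_gt0.
Qed.

(** Powers of m are absorbed by 2^(e m) for every e > 0, however small. *)
Lemma powR_le_exp2 (R : realType) (b e : R) : 0 < e ->
  exists2 C, 0 < C & forall m, m.+1%:R `^ b <= C * 2 `^ (e * m%:R).
Proof.
(* This slope makes |b| t (m+1) at most e ln 2 (m+1); the + 1 avoids division by 0. *)
move=> e0; pose t : R := e * ln 2 / (`|b| + 1).
have b0 := normr_ge0 b.
have l2 : 0 < ln 2 :> R by rewrite ln_gt0// ltr1n.
have t0 : 0 < t by rewrite divr_gt0 ?mulr_gt0//; lra.
exists (expR (e * ln 2 - `|b| * ln t)); first exact: expR_gt0.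
move=> m; have m1 : 0 <= ln (m.+1%:R : R) by rewrite ln_ge0// ler1n.
rewrite /powR !pnatr_eq0/= -expRD ler_expR.
apply: (@le_trans _ _ (`|b| * ln m.+1%:R)).
  by rewrite ler_wpM2r// ler_norm.
apply: (@le_trans _ _ (`|b| * (t * m.+1%:R - ln t))).
  by rewrite ler_wpM2l// ln_le_affine.
have : `|b| * t <= e * ln 2.
  rewrite /t mulrCA ger_pMr ?mulr_gt0// ler_pdivrMr; lra.
have : 0 <= m%:R :> R by [].
rewrite -natr1; nra.
Qed.

(** * The norming sequence *)

(** The value of x^(1/alpha) (log x)^b at x = 2^k, up to a constant factor.  The
    n-th norming constant is [dyadic_norm alpha b (trunc_log 2 n)]: constant on each
    dyadic block, which turns sums over n into sums over k weighted by 2^k. *)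
Definition dyadic_norm (R : realType) (alpha b : R) (k : nat) : R :=
  2 `^ (k%:R / alpha) * k.+1%:R `^ b.

Lemma dyadic_norm_gt0 (R : realType) (alpha b : R) k : 0 < dyadic_norm alpha b k.
Proof. by rewrite mulr_gt0// powR_gt0// ltr0n. Qed.

Lemma dyadic_norm0 (R : realType) (alpha b : R) : dyadic_norm alpha b 0 = 1.
Proof. by rewrite /dyadic_norm mul0r powRr0 powR1 mulr1. Qed.

(** Geometric growth strictly faster than 2^m, because 1/alpha > 1; half of the
    excess exponent pays for the factor (m+1)^|b| that the logarithms contribute.
    This is where alpha < 1 enters: it makes the tails
    sum_(j >= k) 2^j / dyadic_norm j comparable to their first term. *)
Lemma dyadic_norm_growth (R : realType) (alpha b : R) : 0 < alpha -> alpha < 1 ->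
  exists r D : R, [/\ 0 < r, r < 1, 0 < D & forall j m,
    dyadic_norm alpha b j * 2 ^+ m <= D * r ^+ m * dyadic_norm alpha b (j + m)].
Proof.
(* Half of the excess 1/alpha - 1 goes to r^m, the other half to (m+1)^|b|. *)
move=> a0 a1; pose g : R := (alpha^-1 - 1) / 2.
have g0 : 0 < g by rewrite divr_gt0// subr_gt0 invf_gt1.
have [D D0 HD] := @powR_le_exp2 R `|b| g g0.
exists (2 `^ (- g)), D; split => //.
  rewrite powRN invf_lt1 ?powR_gt0// /powR pnatr_eq0/= expR_gt1.
  by rewrite mulr_gt0// ln_gt0// ltr1n.
move=> j m; rewrite /dyadic_norm.
have jm : j.+1%:R `^ b <= m.+1%:R `^ `|b| * (j + m).+1%:R `^ b :> R.
  apply: powR_le_comparable; rewrite ?ltr0n// -natrM ler_nat; nia.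
have P0 : 0 < (j + m).+1%:R `^ b :> R by rewrite powR_gt0// ltr0n.
have Q0 : 0 < 2 `^ (j%:R / alpha) :> R by rewrite powR_gt0.
have -> : (2 ^+ m : R) = 2 `^ m%:R by rewrite powR_mulrn.
have -> : ((2 `^ (- g)) ^+ m : R) = 2 `^ (- g * m%:R) by rewrite powRrM powR_mulrn// powR_ge0.
have e1 : 2 `^ ((j + m)%:R / alpha) =
   2 `^ (j%:R / alpha) * 2 `^ m%:R * (2 `^ (g * m%:R) * 2 `^ (g * m%:R)) :> R.
  rewrite -!powRD ?pnatr_eq0 ?implybT//; congr (_ `^ _).
  by rewrite natrD /g; field; rewrite gt_eqF.
have e2 : 2 `^ (- g * m%:R) * 2 `^ (g * m%:R) = 1 :> R.
  by rewrite -powRD ?pnatr_eq0 ?implybT// mulNr addNr powRr0.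
rewrite e1.
have -> : D * 2 `^ (- g * m%:R) * (2 `^ (j%:R / alpha) * 2 `^ m%:R *
      (2 `^ (g * m%:R) * 2 `^ (g * m%:R)) * (j + m).+1%:R `^ b) =
    (2 `^ (- g * m%:R) * 2 `^ (g * m%:R)) * (2 `^ (j%:R / alpha) * 2 `^ m%:R *
      (D * 2 `^ (g * m%:R) * (j + m).+1%:R `^ b)) by ring.
rewrite e2 mul1r.
rewrite mulrAC -!mulrA ler_pM2l// ler_pM2l ?powR_gt0// !mulrA.
apply: (le_trans jm); by rewrite ler_pM2r.
Qed.

(** For b < 0 the norming constants need not be monotone; being so up to a
    factor D is enough to compare sums with their normed versions. *)
Lemma dyadic_norm_quasimono (R : realType) (alpha b : R) : 0 < alpha -> alpha < 1 ->
  exists2 D : R, 0 < D & forall i j, (i <= j)%N ->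
   dyadic_norm alpha b (trunc_log 2 i) <= D * dyadic_norm alpha b (trunc_log 2 j).
Proof.
move=> a0 a1; have [r [D [r0 r1 D0 H]]] := dyadic_norm_growth b a0 a1.
exists D => // i j ij.
have {ij} := leq_trunc_log 2 ij.
move: (trunc_log 2 i) (trunc_log 2 j) => {}i {}j ij.
have := H i (j - i)%N; rewrite subnKC// => h.
have ci := dyadic_norm_gt0 alpha b i; have cj := dyadic_norm_gt0 alpha b j.
apply: (@le_trans _ _ (dyadic_norm alpha b i * 2 ^+ (j - i))).
  by rewrite ler_peMr ?(ltW ci)// exprn_ege1// ler1n.
apply: (le_trans h); rewrite ler_pM2r// ger_pMr// exprn_ile1// ltW//.
Qed.

(** With k = trunc_log 2 n one has 2^k <= n < 2^(k+1) and ln n is comparable to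
    k + 1, so [powR_le_comparable] applies to both factors. *)
Lemma dyadic_norm_comparable (R : realType) (alpha b : R) : 0 < alpha ->
  exists2 C : R, 0 < C & forall n, (1 < n)%N ->
    dyadic_norm alpha b (trunc_log 2 n) <= C * (n%:R `^ alpha^-1 * ln n%:R `^ b) /\
    n%:R `^ alpha^-1 * ln n%:R `^ b <= C * dyadic_norm alpha b (trunc_log 2 n).
Proof.
move=> a0; have l2 : 0 < ln 2 :> R by rewrite ln_gt0// ltr1n.
pose c : R := 1 + 2 / ln 2.
have il2 : 0 < 2 / ln 2 :> R by rewrite divr_gt0.
exists (2 `^ `|alpha^-1| * c `^ `|b|); first by rewrite mulr_gt0// powR_gt0// /c; lra.
move=> n n1; pose k := trunc_log 2 n.
have k1 : (0 < k)%N by rewrite trunc_log_gt0.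
have n0 : 0 < n%:R :> R by rewrite ltr0n ltnW.
have kn : 2 ^+ k <= n%:R :> R by rewrite -natrX ler_nat trunc_logP// ltnW.
have nk : n%:R <= 2 * 2 ^+ k :> R by rewrite -exprS -natrX ler_nat ltnW// trunc_log_ltn.
have ln0 : 0 < ln n%:R :> R by rewrite ln_gt0// ltr1n.
have kR : 1 <= k%:R :> R by rewrite ler1n.
have lnk : k%:R * ln 2 <= ln n%:R :> R.
  by rewrite mulr_natl -lnXn// ler_ln ?posrE// exprn_gt0.
have lnk2 : ln n%:R <= k.+1%:R * ln 2 :> R.
  by rewrite mulr_natl -lnXn// ler_ln ?posrE// ?exprn_gt0// exprS.
have lt2 : ln 2 <= 1 :> R by have := @le_ln1Dx R 1; rewrite -natr1 addrC; apply; lra.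
have h1 : ln n%:R <= c * k.+1%:R.
  rewrite /c; move: lnk2; rewrite -natr1; nra.
have h2 : k.+1%:R <= c * ln n%:R.
  have : k%:R <= (ln 2)^-1 * ln n%:R :> R by rewrite mulrC ler_pdivlMr.
  rewrite /c -natr1; nra.
have p2 : 0 < 2 ^+ k :> R by rewrite exprn_gt0.
have E : 2 `^ (k%:R / alpha) = (2 ^+ k) `^ alpha^-1 :> R by rewrite powRrM powR_mulrn.
rewrite /dyadic_norm -/k E; split; rewrite mulrACA ler_pM ?powR_ge0//;
  apply: powR_le_comparable; rewrite ?ltr0n//;
  first [exact: h1|exact: h2|exact: nk|exact: ltnW|lra].
Qed.

(** The block of indices i with trunc_log 2 i = k has 2^k elements. *)
Lemma sum_trunc_log (R : realType) (f : nat -> R) K :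
  \sum_(1 <= i < 2 ^ K) f (trunc_log 2 i) = \sum_(0 <= k < K) 2 ^+ k * f k.
Proof.
elim: K => [|K IH]; first by rewrite big_geq// big_geq.
rewrite big_nat_recr//= -IH (@big_cat_nat _ _ _ (2 ^ K)%N)//=; last 2 first.
  by rewrite expn_gt0.
  by rewrite leq_exp2l.
congr (_ + _); rewrite (eq_big_nat _ _ (F2 := fun=> f K)).
  rewrite big_const_nat iter_addr_0 expnS mul2n -addnn addnK.
  by rewrite -[in RHS]natrX mulr_natl.
by move=> i /andP[h1 h2]; congr f; apply: trunc_log_eq => //; rewrite h1 h2.
Qed.

(** The scale of x.  The last k is taken, and not the first crossing, since the
    norming constants are only eventually increasing when b < 0. *)
Lemma last_dyadic_norm (R : realType) (alpha b x : R) : 0 < alpha -> alpha < 1 ->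
  1 <= x -> exists k, dyadic_norm alpha b k <= x /\
    forall j, (k < j)%N -> x < dyadic_norm alpha b j.
Proof.
move=> a0 a1 x1; have [r [D [r0 r1 D0 H]]] := dyadic_norm_growth b a0 a1.
have cD m : 2 ^+ m <= D * dyadic_norm alpha b m.
  have := H 0%N m; rewrite dyadic_norm0 mul1r add0n => /le_trans; apply.
  by rewrite ler_pM2r ?dyadic_norm_gt0// ger_pMr// exprn_ile1 ?(ltW r0)// ltW.
have ex : exists N, `[< forall j, (N <= j)%N -> x < dyadic_norm alpha b j >].
  have [N xN] : exists N : nat, D * x < N%:R.
    by exists (Num.bound (D * x)); apply: archi_boundP; rewrite mulr_ge0 ?ltW// (lt_le_trans ltr01).
  exists N; apply/asboolP => j Nj; rewrite -(ltr_pM2l D0).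
  apply: (lt_le_trans _ (cD j)); apply: (lt_le_trans xN).
  by rewrite -natrX ler_nat (leq_trans Nj)// ltnW// ltn_expl.
case: (ex_minnP ex) => -[|k] /asboolP hk kmin.
  by have := hk 0%N isT; rewrite dyadic_norm0 ltNge x1.
exists k; split => //; rewrite leNgt; apply/negP => xk.
suff /kmin : `[< forall j, (k <= j)%N -> x < dyadic_norm alpha b j >] by rewrite ltnn.
by apply/asboolP => j; rewrite leq_eqVlt => /orP[/eqP <-//|/hk].
Qed.

(** * The moment function *)

Lemma logL_ge1 (R : realType) (x : R) : 1 <= logL x.
Proof.
by rewrite /logL -[X in X <= _]expRK ler_ln ?posrE ?lt_max ?expR_gt0// le_max lexx.
Qed.

Lemma ln_le_logL (R : realType) (x : R) : 0 < x -> ln x <= logL x.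
Proof.
by move=> x0; rewrite /logL ler_ln ?posrE ?lt_max ?expR_gt0// le_max lexx orbT.
Qed.

Lemma logL_le (R : realType) (x : R) : 1 <= x -> logL x <= 1 + ln x.
Proof.
move=> x1; rewrite /logL; have l0 := ln_ge0 x1.
by rewrite /Num.max; case: ifP => _; rewrite ?expRK; lra.
Qed.

(** Both bounds come from 2^(k/(2 alpha)) / A <= dyadic_norm k and
    dyadic_norm (k+1) <= B 2^(3(k+1)/(2 alpha)), the polynomial factor being
    absorbed by half an exponent; taking logarithms gives L x of order k. *)
Lemma logL_comparable (R : realType) (alpha b : R) : 0 < alpha ->
  exists2 C : R, 0 < C & forall k x, 1 <= x -> dyadic_norm alpha b k <= x ->
    x < dyadic_norm alpha b k.+1 -> k.+1%:R <= C * logL x /\ logL x <= C * k.+1%:R.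
Proof.
move=> a0.
have l2 : 0 < ln 2 :> R by rewrite ln_gt0// ltr1n.
pose e : R := (2 * alpha)^-1.
have e0 : 0 < e by rewrite invr_gt0 mulr_gt0.
have aE : alpha^-1 = 2 * e by rewrite /e; field; rewrite gt_eqF.
have [A A0 HA] := @powR_le_exp2 R (- b) e e0.
have [B B0 HB] := @powR_le_exp2 R b e e0.
pose u := ln 2 * e.
have u0 : 0 < u by rewrite mulr_gt0.
have n3 := normr_ge0 (ln A); have n4 := normr_ge0 (ln B).
have iu : 0 < u^-1 by rewrite invr_gt0.
have uA : 0 <= u^-1 * (1 + `|ln A|) by rewrite mulr_ge0 ?ltW//; lra.
exists (1 + `|ln B| + 6 * u + u^-1 * (1 + `|ln A|) + 1).
  by lra.
move=> k x x1 ckx xck.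
have x0 : 0 < x by exact: lt_le_trans x1.
have lx := ln_le_logL x0; have lx' := logL_le x1; have L1 := logL_ge1 x.
have k0 : 0 <= k%:R :> R by [].
have hA : u * k%:R <= ln x + ln A.
  rewrite -lnM ?posrE//.
  have -> : u * k%:R = ln (2 `^ (e * k%:R)) by rewrite ln_powR /u; ring.
  rewrite ler_ln ?posrE ?mulr_gt0 ?powR_gt0//.
  have := HA k; rewrite powRN => h.
  apply: (@le_trans _ _ (A * dyadic_norm alpha b k)); last by rewrite mulrC ler_pM2r.
  rewrite /dyadic_norm aE (_ : k%:R * (2 * e) = e * k%:R + e * k%:R); last by ring.
  rewrite powRD ?pnatr_eq0 ?implybT//.
  have P0 : 0 < k.+1%:R `^ b :> R by rewrite powR_gt0// ltr0n.
  have Q0 : 0 < 2 `^ (e * k%:R) :> R by rewrite powR_gt0.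
  move: h; rewrite -[(_ `^ _)^-1]mul1r ler_pdivrMr// => h; nra.
have hB : ln x <= ln B + u * 3 * k.+1%:R.
  have -> : u * 3 * k.+1%:R = ln (2 `^ (3 * e * k.+1%:R)) by rewrite ln_powR /u; ring.
  rewrite -lnM ?posrE ?powR_gt0// ler_ln ?posrE ?mulr_gt0 ?powR_gt0//.
  apply: (le_trans (ltW xck)).
  rewrite /dyadic_norm aE (_ : k.+1%:R * (2 * e) = e * k.+1%:R + e * k.+1%:R); last by ring.
  rewrite (_ : 3 * e * k.+1%:R = e * k.+1%:R + e * k.+1%:R + e * k.+1%:R); last by ring.
  rewrite !powRD ?pnatr_eq0 ?implybT//.
  have Q0 : 0 < 2 `^ (e * k.+1%:R) :> R by rewrite powR_gt0.
  have := HB k.+1; set P := _ `^ b => h.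
  set q := _ `^ (e * _) in Q0 h *.
  by rewrite (_ : B * _ = q * q * (B * q)); [rewrite ler_pM2l// mulr_gt0|ring].
have n1 := ler_norm (ln A); have n2 := ler_norm (ln B).
have hA' : k%:R <= u^-1 * (logL x + `|ln A|).
  by rewrite -(ler_pM2l u0) mulrA mulfV ?gt_eqF// mul1r; lra.
rewrite -natr1; move: hB; rewrite -natr1 => hB.
split.
  apply: (@le_trans _ _ ((u^-1 * (1 + `|ln A|) + 1) * logL x)).
    have : `|ln A| <= `|ln A| * logL x by rewrite ler_peMr.
    nra.
  rewrite ler_pM2r; [nra|lra].
apply: (@le_trans _ _ ((1 + `|ln B| + 6 * u) * (k%:R + 1))); first nra.
rewrite ler_pM2r; [|lra]. 
lra.
Qed.

Definition log_moment (R : realType) (alpha b x : R) : R :=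
  x `^ alpha / logL x `^ (b * alpha).

Lemma log_moment_ge0 (R : realType) (alpha b x : R) : 0 <= log_moment alpha b x.
Proof. by rewrite divr_ge0// powR_ge0. Qed.

Lemma log_moment_le1 (R : realType) (alpha b x : R) : 0 < alpha -> 0 <= x -> x <= 1 ->
  log_moment alpha b x <= 1.
Proof.
move=> a0 x0 x1; rewrite /log_moment.
have -> : logL x = 1.
  rewrite /logL /Num.max; case: ifP => h; last by rewrite expRK.
  by have := lt_le_trans h x1; rewrite expR_lt1 ltNge ler01.
rewrite powR1 divr1 [leRHS](_ : 1 = 1 `^ alpha); last by rewrite powR1.
by rewrite ge0_ler_powR ?nnegrE// ltW.
Qed.

(** The moment function is, up to constants, the inverse of the norming sequence
    n = 2^k |-> dyadic_norm k: raising dyadic_norm k to the power alpha gives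
    2^k (k+1)^(b alpha), and the logarithmic factor cancels against (L x)^(b alpha). *)
Lemma log_moment_comparable (R : realType) (alpha b : R) : 0 < alpha ->
  exists2 C : R, 0 < C & forall k x, 1 <= x -> dyadic_norm alpha b k <= x ->
    x < dyadic_norm alpha b k.+1 ->
    2 ^+ k <= C * log_moment alpha b x /\ log_moment alpha b x <= C * 2 ^+ k.
Proof.
move=> a0; have [C C0 HC] := logL_comparable b a0.
(* The extra 2 C accounts for k + 2 <= 2 (k + 1). *)
pose c := C + C * 2.
have c0 : 0 < c by rewrite /c; lra.
have cp : 0 < c `^ `|b * alpha| by rewrite powR_gt0.
exists (2 * c `^ `|b * alpha|); first by rewrite mulr_gt0.
move=> k x x1 kx xk; have [h1 h2] := HC k x x1 kx xk.
have L1 := logL_ge1 x; have L0 : 0 < logL x by lra.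
have x0 : 0 <= x by lra.
have CK : 0 <= C * k.+1%:R by rewrite mulr_ge0// ltW.
have CL : 0 <= C * logL x by rewrite mulr_ge0// ltW.
have k2 : k.+2%:R <= 2 * k.+1%:R :> R by rewrite -natrM ler_nat mul2n -addnn addSnnS leq_addl.
have k12 : k.+1%:R <= k.+2%:R :> R by rewrite ler_nat.
have Ck12 : C * k.+1%:R <= C * k.+2%:R by rewrite ler_pM2l.
have dE j : dyadic_norm alpha b j `^ alpha = 2 ^+ j * j.+1%:R `^ (b * alpha).
  rewrite /dyadic_norm powRM ?powR_ge0// -!powRrM divfK ?gt_eqF//.
  by rewrite powR_mulrn.
have d0 j : 0 <= dyadic_norm alpha b j by exact/ltW/dyadic_norm_gt0.
have P0 : 0 < logL x `^ (b * alpha) by rewrite powR_gt0.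
have p2 : 0 < 2 ^+ k :> R by rewrite exprn_gt0.
rewrite /log_moment; split.
  rewrite mulrA ler_pdivlMr//.
  have xa : 2 ^+ k * k.+1%:R `^ (b * alpha) <= x `^ alpha.
    by rewrite -dE ge0_ler_powR ?nnegrE// ltW.
  have : logL x `^ (b * alpha) <= c `^ `|b * alpha| * k.+1%:R `^ (b * alpha).
    apply: powR_le_comparable; rewrite ?ltr0n// /c; lra.
  move=> h; apply: (@le_trans _ _ (2 ^+ k * (c `^ `|b * alpha| * k.+1%:R `^ (b * alpha)))).
    by rewrite ler_pM2l.
  have Xp := powR_ge0 x alpha.
  rewrite mulrCA -mulrA mulr_natl mulr2n ler_wpDr ?mulr_ge0 ?(ltW cp)//.
  by rewrite ler_pM2l.
rewrite ler_pdivrMr//.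
have xa : x `^ alpha <= 2 ^+ k.+1 * k.+2%:R `^ (b * alpha).
  by rewrite -dE ge0_ler_powR ?nnegrE ?(ltW a0)// ltW.
have : k.+2%:R `^ (b * alpha) <= c `^ `|b * alpha| * logL x `^ (b * alpha).
  apply: powR_le_comparable; rewrite ?ltr0n// /c; lra.
move=> h; move: xa; rewrite exprS -!mulrA => /le_trans; apply.
rewrite ler_pM2l// mulrCA ler_pM2l// [X in _ <= X]mulrC mulrA mulrC.
Qed.

(** With k the scale of x, the blocks up to k contribute at most their sizes, of
    total order 2^k, and the later blocks form a geometric series starting at order
    2^k.  By [log_moment_comparable] the total is controlled by the moment function.
    Truncating at 1 makes a separate treatment of the large terms unnecessary. *)
Lemma sum_min_le (R : realType) (alpha b : R) : 0 < alpha -> alpha < 1 ->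
  exists2 C : R, 0 < C & forall (x : R) n, 0 <= x ->
    \sum_(1 <= i < n) Num.min (x / dyadic_norm alpha b (trunc_log 2 i)) 1
      <= C * (1 + log_moment alpha b x).
Proof.
move=> a0 a1; have [C C0 HC] := log_moment_comparable b a0.
have [r [D [r0 r1 D0 HD]]] := dyadic_norm_growth b a0 a1.
have s0 : 0 < (1 - r)^-1 by rewrite invr_gt0 subr_gt0.
exists (C * (2 + 2 * (D * (1 - r)^-1))).
  by rewrite mulr_gt0// addr_gt0// !mulr_gt0.
move=> x n x0; pose c := dyadic_norm alpha b.
have cg0 k : 0 < c k by exact: dyadic_norm_gt0.
(* Scales are only defined from dyadic_norm 0 = 1 on; y replaces x by 1 below that. *)
pose y := Num.max 1 x.
have y1 : 1 <= y by rewrite le_max lexx.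
have xy : x <= y by rewrite le_max lexx orbT.
have [k [ky yk]] := last_dyadic_norm b a0 a1 y1.
have [h _] := HC k y y1 ky (yk k.+1 (ltnSn k)).
have hy : log_moment alpha b y <= 1 + log_moment alpha b x.
  rewrite /y /Num.max; case: ifP => _; first by rewrite lerDr.
  by rewrite -[leLHS]addr0 lerD ?log_moment_le1// log_moment_ge0.
have m0 u v : 0 <= u -> 0 < v -> 0 <= Num.min (u / v) 1 :> R.
  by move=> u0 v0; rewrite le_min ler01 divr_ge0// ltW.
have term0 i : 0 <= 2 ^+ i * Num.min (y / c i) 1.
  by rewrite mulr_ge0 ?exprn_ge0// m0// (le_trans _ y1).
have low K : \sum_(0 <= i < K) 2 ^+ i * Num.min (y / c i) 1 <= 2 ^+ K.
  elim: K => [|K IH]; first by rewrite big_geq.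
  rewrite big_nat_recr//= exprS mulr_natl mulr2n lerD//.
  by rewrite ler_piMr ?exprn_ge0// ge_min lexx orbT.
have high m : \sum_(0 <= i < k.+1 + m) 2 ^+ i * Num.min (y / c i) 1
    <= 2 ^+ k.+1 + \sum_(0 <= i < m) 2 ^+ k.+1 * D * r ^+ i.
  elim: m => [|m IH]; first by rewrite addn0 [X in _ + X]big_geq// addr0.
  rewrite addnS big_nat_recr//= [in leRHS]big_nat_recr//= addrA lerD//.
  apply: (@le_trans _ _ (2 ^+ (k.+1 + m) * (c k.+1 / c (k.+1 + m)))).
    rewrite ler_wpM2l ?exprn_ge0// ge_min ler_pM2r ?invr_gt0//.
    by rewrite ltW// yk.
  rewrite mulrA ler_pdivrMr// exprD -!mulrA ler_pM2l ?exprn_gt0// mulrA.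
  by rewrite mulrC HD.
apply: (@le_trans _ _ (2 ^+ k.+1 + \sum_(0 <= i < n) 2 ^+ k.+1 * D * r ^+ i)); last first.
  have -> : \sum_(0 <= i < n) 2 ^+ k.+1 * D * r ^+ i = series (geometric (2 ^+ k.+1 * D) r) n.
    by rewrite /series.
  have : series (geometric (2 ^+ k.+1 * D) r) n <= 2 ^+ k.+1 * D * (1 - r)^-1.
    apply: geometric_le_lim => //; first by rewrite mulr_ge0 ?exprn_ge0// ltW.
    by rewrite ger0_norm// ltW.
  rewrite exprS => g.
  apply: (@le_trans _ _ ((2 + 2 * (D * (1 - r)^-1)) * 2 ^+ k)).
    by move: g; lra.
  rewrite [C * _]mulrC -mulrA ler_pM2l; last by rewrite addr_gt0// !mulr_gt0.
  by rewrite (le_trans h)// ler_pM2l.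
apply: (le_trans _ (high n)).
apply: (@le_trans _ _ (\sum_(0 <= i < n) 2 ^+ i * Num.min (y / c i) 1)); last first.
  rewrite [leRHS](@big_cat_nat _ _ _ n)//= ?leq_addl// lerDl.
  by rewrite sumr_ge0.
(* Completing the range to i < 2^n, which contains i < n, gives full blocks. *)
rewrite -(sum_trunc_log (fun i => Num.min (y / c i) 1)).
have [n0|n0] := posnP n.
  by rewrite n0 big_geq// sumr_ge0// => i _; rewrite m0// (le_trans _ y1).
rewrite [leRHS](@big_cat_nat _ _ _ n)//=; last by rewrite ltnW// ltn_expl.
apply: ler_wpDr; first by rewrite sumr_ge0// => i _; rewrite m0// (le_trans _ y1).
apply: ler_sum => i _; rewrite le_min ge_min ge_min lexx orbT andbT.
by rewrite ler_pM2r ?invr_gt0// xy.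
Qed.

(** The block of the scale k of x alone contributes 2^k indices to the count. *)
Lemma log_moment_le_count (R : realType) (alpha b : R) : 0 < alpha -> alpha < 1 ->
  exists2 C : R, 0 < C & forall x : R, 0 <= x -> exists n,
    log_moment alpha b x <=
      C * (1 + \sum_(1 <= i < n) (dyadic_norm alpha b (trunc_log 2 i) <= x)%R%:R).
Proof.
move=> a0 a1; have [C C0 HC] := log_moment_comparable b a0.
exists (1 + C) => [|x x0]; first by lra.
have [x1|/ltW x1] := leP x 1.
  exists 0%N; rewrite big_geq// addr0 mulr1 (le_trans (log_moment_le1 b a0 x0 x1))//.
  by rewrite lerDl ltW.
have [k [kx xk]] := last_dyadic_norm b a0 a1 x1.
have [_ h] := HC k x x1 kx (xk k.+1 (ltnSn k)).
exists (2 ^ k.+1)%N; rewrite (sum_trunc_log (fun i => (dyadic_norm alpha b i <= x)%R%:R)).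
rewrite big_nat_recr//= kx mulr1 (le_trans h)//.
set s := \sum_(_ <= _ < _) _; have s0 : 0 <= s.
  by rewrite sumr_ge0// => i _; rewrite mulr_ge0// exprn_ge0.
have : 0 <= 2 ^+ k :> R by rewrite exprn_ge0.
nra.
Qed.

Lemma measurable_log_moment (R : realType) (alpha b : R) :
  measurable_fun [set: R] (fun x => log_moment alpha b `|x|).
Proof.
rewrite (_ : (fun x => _) = fun x => `|x| `^ alpha * logL `|x| `^ (- (b * alpha))).
  apply: measurable_funM.
    exact: (measurableT_comp (measurable_powR alpha) (@normr_measurable R setT)).
  apply: (measurableT_comp (measurable_powR (- (b * alpha)))).
  apply: (@measurableT_comp _ _ _ _ _ _ _ _ (fun x : R => Num.max (expR 1) `|x|)
    (@measurable_ln R)).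
  by apply: measurable_maxr => //; exact: normr_measurable.
by apply/funext => x; rewrite powRN.
Qed.

(** * Limits superior of iterated-logarithm roots *)

Lemma lnln_ge_near (R : realType) (K : R) :
  exists2 N, (1 < N)%N & forall n, (N <= n)%N -> K <= ln (ln n%:R).
Proof.
pose N := (Num.bound (expR (expR K))).+2.
exists N => // n Nn.
have hn : expR (expR K) <= n%:R.
  apply: ltW; apply: lt_le_trans (archi_boundP (expR_ge0 _)) _.
  by rewrite ler_nat (leq_trans _ Nn)// /N; lia.
have n0 : 0 < n%:R :> R := lt_le_trans (expR_gt0 _) hn.
have h : expR K <= ln n%:R by rewrite -[leLHS]expRK ler_ln ?posrE ?expR_gt0.
by rewrite -[leLHS]expRK ler_ln ?posrE ?expR_gt0// (lt_le_trans (expR_gt0 _) h).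
Qed.

Lemma lee_expR_addr (R : realType) (b : R) (x : \bar R) :
  (forall e, 0 < e -> (x <= (expR (b + e))%:E)%E) -> (x <= (expR b)%:E)%E.
Proof.
case: x => [r| |] h; rewrite ?leNye//; last by have := h 1 ltr01.
rewrite lee_fin leNgt; apply/negP => br.
have r0 : 0 < r := lt_trans (expR_gt0 _) br.
have lr : b < ln r by rewrite -[ltLHS]expRK ltr_ln ?posrE ?expR_gt0.
have := h ((ln r - b) / 2); rewrite divr_gt0 ?subr_gt0// => /(_ isT).
rewrite lee_fin -[r in r <= _]lnK ?posrE// ler_expR; lra.
Qed.

Lemma lee_expR_subr (R : realType) (b : R) (x : \bar R) :
  (forall e, 0 < e -> ((expR (b - e))%:E <= x)%E) -> ((expR b)%:E <= x)%E.
Proof.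
case: x => [r| |] h; rewrite ?leey//; last by have := h 1 ltr01.
rewrite lee_fin leNgt; apply/negP => br.
have r0 : 0 < r by have := h 1 ltr01; rewrite lee_fin; apply: lt_le_trans; exact: expR_gt0.
have lr : ln r < b by rewrite -[ltRHS]expRK ltr_ln ?posrE ?expR_gt0.
have := h ((b - ln r) / 2); rewrite divr_gt0 ?subr_gt0// => /(_ isT).
rewrite lee_fin -[r in _ <= r]lnK ?posrE// ler_expR; lra.
Qed.

(** The scale c n^(1/alpha) (log n)^b is turned into e^b by the root of order
    log log n; the constant factor disappears in the limit. *)
Lemma lnln_root (R : realType) (M b n : R) : 0 < M -> 0 < ln (ln n) ->
  (M * ln n `^ b) `^ (ln (ln n))^-1 = expR (b + ln M / ln (ln n)).
Proof.
move=> M0 t0.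
have l0 : 0 < ln n.
  by rewrite ltNge; apply/negP => /ln0 h; rewrite h ltxx in t0.
rewrite {1}/powR gt_eqF ?mulr_gt0 ?powR_gt0// lnM ?posrE ?powR_gt0// ln_powR.
by congr expR; field; rewrite gt_eqF.
Qed.

Lemma limn_esup_lnln_root_le (R : realType) (p b M : R) (s : nat -> R) :
  (forall n, (1 < n)%N -> `|s n| <= M * (n%:R `^ p * ln n%:R `^ b)) ->
  (limn_esup (fun n => (`|s n / n%:R `^ p| `^ (ln (ln n%:R))^-1)%:E) <= (expR b)%:E)%E.
Proof.
move=> h; apply: lee_expR_addr => e e0; pose m := `|M| + 1.
have m0 : 0 < m by rewrite ltr_wpDl.
(* From this N on the constant m changes the exponent by at most e. *)
have [N N1 HN] := lnln_ge_near (Num.max 1 (ln m / e)).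
apply: (@le_trans _ _ (ereal_sup
    [set (`|s n / n%:R `^ p| `^ (ln (ln n%:R))^-1)%:E | n in [set n | (N <= n)%N]])).
  by apply: ereal_inf_lbound; exists [set n | (N <= n)%N] => //; exists N.
apply: ge_ereal_sup => _ [n /= Nn <-]; rewrite lee_fin.
have := HN n Nn; rewrite ge_max => /andP[t1 tm].
have t0 : 0 < ln (ln n%:R) :> R := lt_le_trans ltr01 t1.
apply: (@le_trans _ _ (expR (b + ln m / ln (ln n%:R)))); last first.
  by rewrite ler_expR lerD2l ler_pdivrMr// mulrC -ler_pdivrMr.
rewrite -lnln_root//; apply: ge0_ler_powR; rewrite ?nnegrE ?invr_ge0 ?(ltW t0)//.
  by rewrite mulr_ge0 ?powR_ge0// ltW.
have n0 : 0 < n%:R `^ p :> R by rewrite powR_gt0// ltr0n; lia.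
rewrite normrM normfV (gtr0_norm n0) ler_pdivrMr//.
rewrite (le_trans (h n (leq_trans N1 Nn)))// mulrAC -[leRHS]mulrA.
by rewrite ler_wpM2r ?mulr_ge0 ?powR_ge0// (le_trans (ler_norm M))// lerDl.
Qed.

Lemma limn_esup_lnln_root_ge (R : realType) (p b c : R) (s : nat -> R) : 0 < c ->
  (forall N, exists2 n, (N <= n)%N & c * (n%:R `^ p * ln n%:R `^ b) <= `|s n|) ->
  ((expR b)%:E <= limn_esup (fun n => (`|s n / n%:R `^ p| `^ (ln (ln n%:R))^-1)%:E))%E.
Proof.
move=> c0 h; apply: lee_expR_subr => e e0.
(* From this N on the constant c changes the exponent by at most e. *)
have [N N1 HN] := lnln_ge_near (Num.max 1 (- ln c / e)).
apply: le_ereal_inf_tmp => _ [V [m _ mV] <-].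
have [n Nn hn] := h (maxn N m); move: Nn; rewrite geq_max => /andP[Nn mn].
apply: (@le_trans _ _ (`|s n / n%:R `^ p| `^ (ln (ln n%:R))^-1)%:E); last first.
  by apply: ereal_sup_ubound; exists n => //; exact: mV.
rewrite lee_fin.
have := HN n Nn; rewrite ge_max => /andP[t1 tm].
have t0 : 0 < ln (ln n%:R) :> R := lt_le_trans ltr01 t1.
apply: (@le_trans _ _ (expR (b + ln c / ln (ln n%:R)))).
  rewrite ler_expR lerD2l ler_pdivlMr//.
  by move: tm; rewrite ler_pdivrMr// mulNr; lra.
rewrite -lnln_root//; apply: ge0_ler_powR; rewrite ?nnegrE ?invr_ge0 ?(ltW t0)//.
  by rewrite mulr_ge0 ?powR_ge0// ltW.
have n0 : 0 < n%:R `^ p :> R by rewrite powR_gt0// ltr0n; lia.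
rewrite normrM normfV (gtr0_norm n0) ler_pdivlMr//.
by rewrite (le_trans _ hn)// -mulrA [X in c * X]mulrC.
Qed.

(** * Borel-Cantelli for independent events *)

Lemma measurable_preimage_RV (d : measure_display) (T : measurableType d) (R : realType)
    (P : probability T R) (X : {RV P >-> R}) (A : set R) :
  measurable A -> measurable (X @^-1` A).
Proof. by move=> mA; rewrite -[_ @^-1` _]setTI; exact: measurable_funPT. Qed.

(** Independence, then 1 - p <= exp (- p) for each factor. *)
Lemma prob_bigcap_preimageC_le (d : measure_display) (T : measurableType d) (R : realType)
    (P : probability T R) (X : nat -> {RV P >-> R}) (A : nat -> set R) m n :
  independent_RVs X -> (forall i, measurable (A i)) ->
  (P (\bigcap_(i in [set i | (m <= i < n)%N]) (X i @^-1` (~` A i))) <=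
   (expR (- \sum_(m <= i < n) fine (P (X i @^-1` A i))))%:E)%E.
Proof.
move=> hX mA; pose J := [fset i in index_iota m n]%fset.
have -> : [set i | (m <= i < n)%N] = [set` J].
  by apply/seteqP; split=> i /=; rewrite !inE mem_index_iota.
rewrite hX; last by move=> i; exact: measurableC.
rewrite (perm_big (index_iota m n))/=; last first.
  apply: uniq_perm; [exact: fset_uniq|exact: iota_uniq|].
  by move=> i; rewrite !inE.
elim: (index_iota m n) => [|i s IH]; first by rewrite !big_nil oppr0 expR0.
rewrite !big_cons opprD expRD EFinM lee_pmul//; first exact: prode_ge0.
have mXA := measurable_preimage_RV (X i) (mA i).
rewrite preimage_setC probability_setC//.
rewrite -[P _]fineK ?fin_num_measure// -EFinB lee_fin.
exact: expR_ge1Dx.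
Qed.

(** Given N, the event that A i fails for all i >= N has probability at most
    exp (- sum_(N <= i < n) P (X i in A i)) for every n, hence 0. *)
Lemma second_borel_cantelli (d : measure_display) (T : measurableType d) (R : realType)
    (P : probability T R) (X : nat -> {RV P >-> R}) (A : nat -> set R) :
  independent_RVs X -> (forall i, measurable (A i)) ->
  (\sum_(i <oo) P (X i @^-1` A i) = +oo)%E ->
  {ae P, forall w, forall N, exists2 i, (N <= i)%N & A i (X i w)}.
Proof.
move=> hX mA AX; apply: ae_foralln => N.
pose p i := fine (P (X i @^-1` A i)).
have mXA i := measurable_preimage_RV (X i) (mA i).
have p0 i : 0 <= p i by rewrite fine_ge0.
have pE i : P (X i @^-1` A i) = (p i)%:E by rewrite fineK ?fin_num_measure.
pose B := \bigcap_(i in [set i | (N <= i)%N]) (X i @^-1` (~` A i)).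
have mB : measurable B.
  apply: bigcap_measurableType => i _.
  by apply: measurable_preimage_RV; exact: measurableC.
exists B; split => //; last first.
  by move=> w h i /= Ni Aiw; apply: h; exists i.
have Ble n : (P B <= (expR (- \sum_(N <= i < n) p i))%:E)%E.
  apply: le_trans (prob_bigcap_preimageC_le N n hX mA).
  apply: le_measure; rewrite ?inE//.
    apply: bigcap_measurableType => i _; apply: measurable_preimage_RV; exact: measurableC.
  by move=> w h i /= /andP[Ni _]; exact: h.
have big K : exists n, K <= \sum_(N <= i < n) p i.
  apply: contrapT => /forallNP h.
  suff : (\sum_(i <oo) P (X i @^-1` A i) <= (\sum_(0 <= i < N) p i + K)%:E)%E.
    by rewrite AX leye_eq.
  apply: lime_le; first by apply: is_cvg_nneseries.
  apply: nearW => n.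
  under eq_bigr do rewrite pE.
  rewrite sumEFin lee_fin.
  have [nN|Nn] := leqP n N.
    rewrite (@big_cat_nat _ _ _ n 0 N)//= -addrA lerDl addr_ge0 ?sumr_ge0//.
    have /negP := h 0%N; rewrite big_geq// -ltNge => /ltW; exact.
  rewrite (@big_cat_nat _ _ _ N 0 n)//= ?(ltnW Nn)// lerD2l.
  by have /negP := h n; rewrite -ltNge => /ltW.
apply/eqP; rewrite eq_le measure_ge0 andbT; apply/lee_addgt0Pr => e e0.
have [n hn] := big (- ln e).
rewrite add0e (le_trans (Ble n))// lee_fin -[leRHS]lnK ?posrE// ler_expR.
by rewrite lerNl.
Qed.

(** * Growth of the partial sums *)

(** The truncated series converges, so its terms tend to 0 and all but finitely
    many of them are not truncated. *)
Lemma bounded_sum_of_min (R : realType) (y : nat -> R) (K : R) :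
  (forall i, 0 <= y i) -> (forall n, \sum_(0 <= i < n) Num.min (y i) 1 <= K) ->
  exists M, forall n, \sum_(0 <= i < n) y i <= M.
Proof.
move=> y0 yK; pose u i := Num.min (y i) 1.
have u0 i : 0 <= u i by rewrite le_min y0 ler01.
have cu : cvgn (series u).
  apply: nondecreasing_is_cvgn; first by apply: nondecreasing_series => n _ _.
  by exists K => _ [n _ <-]; exact: yK.
have [N _ HN] : \forall n \near \oo, u n < 1.
  by apply: (cvgr_lt 0) => //; exact: cvg_series_cvg_0.
have eqy i : (N <= i)%N -> y i = u i.
  by move=> /HN; rewrite /u /= gt_min ltxx orbF => yi; rewrite min_l// ltW.
exists (\sum_(0 <= i < N) y i + K) => n.
apply: (@le_trans _ _ (\sum_(0 <= i < N) y i + \sum_(0 <= i < n) u i)); last first.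
  by rewrite lerD2l.
elim: n => [|n IH]; first by rewrite !(@big_geq _ _ _ 0 0)// addr0 sumr_ge0.
have [nN|Nn] := ltnP n N.
  rewrite ler_wpDr ?sumr_ge0// (@big_cat_nat _ _ _ n.+1 0 N)//= lerDl.
  by rewrite sumr_ge0.
by rewrite big_nat_recr//= [in leRHS](@big_nat_recr _ _ _ n)//= addrA (eqy n)// lerD2r.
Qed.

(** Both sides are integrals against the common law of X i and X j. *)
Lemma expectation_identically_distributed (d : measure_display) (T : measurableType d) (R : realType)
    (P : probability T R) (X : nat -> {RV P >-> R}) (f : R -> \bar R) i j :
  identically_distributed X -> measurable_fun [set: R] f -> (forall x, (0 <= f x)%E) ->
  (\int[P]_w f (X i w) = \int[P]_w f (X j w))%E.
Proof.
move=> hX mf f0.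
rewrite -(ge0_integral_distribution (X i) mf f0) -(ge0_integral_distribution (X j) mf f0).
by apply: eq_measure_integral => A mA _; exact: hX.
Qed.

(** By Tonelli and identical distribution, sum_i min(|X_i| / c_i, 1) has finite
    expectation, with c_i the norming constants; so sum_i |X_i| / c_i is almost surely
    finite, and |S_n| is at most D c_n times that sum. *)
Lemma partial_sum_upper_growth (d : measure_display) (T : measurableType d) (R : realType)
    (P : probability T R) (X : nat -> {RV P >-> R}) (alpha b : R) :
  0 < alpha -> alpha < 1 -> identically_distributed X ->
  (\int[P]_w (log_moment alpha b `|X 0%N w|)%:E < +oo)%E ->
  {ae P, forall w, exists M, forall n, (1 < n)%N ->
    `|partial_sum X n w| <= M * (n%:R `^ alpha^-1 * ln n%:R `^ b)}.
Proof.
move=> a0 a1 hX fin.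
have [C C0 HC] := sum_min_le b a0 a1.
have [D D0 HD] := dyadic_norm_quasimono b a0 a1.
have [B B0 HB] := dyadic_norm_comparable b a0.
have I1 : (\int[P]_w 1 = 1)%E by rewrite integral_cst// mul1e; exact: probability_setT.
pose c i := dyadic_norm alpha b (trunc_log 2 i).
have c0 i : 0 < c i by exact: dyadic_norm_gt0.
pose f (i : nat) (x : R) := (Num.min (`|x| / c i) 1)%:E.
have mf i : measurable_fun [set: R] (f i).
  apply/measurable_EFinP; apply: measurable_minr => //.
  by apply: measurable_funM => //; exact: normr_measurable.
have f0 i x : (0 <= f i x)%E.
  by rewrite lee_fin le_min ler01 divr_ge0// ltW.
have mfX i j : measurable_fun [set: T] (fun w => f i (X j w)).
  by apply: measurableT_comp; [exact: mf|exact: measurable_funPT].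
have mphi : measurable_fun [set: T] (fun w => (log_moment alpha b `|X 0%N w|)%:E).
  by apply/measurable_EFinP; apply: (measurableT_comp (measurable_log_moment alpha b));
    exact: measurable_funPT.
have intf : (\int[P]_w (\sum_(i <oo) f i (X i w)) < +oo)%E.
  rewrite integral_nneseries//.
  under eq_eseriesr do rewrite (expectation_identically_distributed _ 0%N hX)//.
  rewrite -integral_nneseries//.
  apply: (@le_lt_trans _ _ (\int[P]_w ((1 + C)%:E * (1 + (log_moment alpha b `|X 0%N w|)%:E)))%E).
    apply: ge0_le_integral => //.
    - by move=> w _; exact: nneseries_ge0.
    - exact: ge0_emeasurable_sum.
    - by apply: emeasurable_funM => //; exact: emeasurable_funD.
    move=> w _; apply: lime_le; first by apply: is_cvg_nneseries.
    apply: nearW => n; rewrite sumEFin -EFinD -EFinM lee_fin mulrDl mul1r.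
    have h := HC `|X 0%N w| n (normr_ge0 _).
    have l0 := log_moment_ge0 alpha b `|X 0%N w|.
    (* Index 0 lies outside the range of [sum_min_le]; its term is at most 1. *)
    case: n h => [|n] h; first by rewrite big_geq// addr_ge0 ?mulr_ge0 ?addr_ge0// ltW.
    rewrite big_ltn// lerD// (@le_trans _ _ 1) ?ge_min ?lexx ?orbT//.
    by rewrite lerDl.
  rewrite ge0_integralZl//; last 3 first.
  - exact: emeasurable_funD.
  - by move=> w _; rewrite adde_ge0// lee_fin log_moment_ge0.
  - by rewrite lee_fin; lra.
  rewrite ge0_integralD//; last by move=> w _; rewrite lee_fin log_moment_ge0.
  rewrite I1.
  rewrite lte_mul_pinfty// ?lee_fin; first by lra.
  by apply: lte_add_pinfty => //; exact: ltry.
have : {ae P, forall w, setT w -> (\sum_(i <oo) f i (X i w))%E \is a fin_num}.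
  apply: integrable_ae => //; apply/integrableP; split.
    exact: ge0_emeasurable_sum.
  rewrite (eq_integral (fun w => \sum_(i <oo) f i (X i w))%E)// => w _.
  by rewrite gee0_abs//; apply: nneseries_ge0 => i _ _; exact: f0.
apply: filterS => w /(_ I) /fineK; set K := fine _ => KE.
have [M HM] : exists M, forall n, \sum_(0 <= i < n) `|X i w| / c i <= M.
  apply: (@bounded_sum_of_min _ _ K) => [i|n]; first by rewrite divr_ge0// ltW.
  rewrite -lee_fin -sumEFin KE.
  exact: (@nneseries_lim_ge R (fun i => f i (X i w)) xpredT 0 n (fun i _ _ => f0 i (X i w))).
exists (M * D * B) => n n1.
have M0 : 0 <= M by have := HM 0%N; rewrite big_geq.
have [hB _] := HB n n1.
rewrite -!mulrA; apply: (@le_trans _ _ (M * (D * c n))); last first.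
  by rewrite ler_wpM2l// ler_wpM2l// ltW.
rewrite /partial_sum; apply: (le_trans (ler_norm_sum _ _ _)).
apply: (@le_trans _ _ (\sum_(1 <= i < n.+1) `|X i w| / c i * (D * c n))).
  rewrite big_nat_cond [leRHS]big_nat_cond; apply: ler_sum => i /andP[/andP[_ i1] _].
  by rewrite mulrAC ler_pdivlMr// ler_wpM2l// HD.
rewrite -mulr_suml ler_pM2r ?mulr_gt0//.
apply: (le_trans _ (HM n.+1)); rewrite [leRHS]big_ltn// lerDr divr_ge0// ltW//.
Qed.

(** An infinite moment means sum_i P(|X_i| >= c_i) = +oo, so |X_i| >= c_i infinitely
    often by the second Borel-Cantelli lemma.  As X_i = S_i - S_(i-1), one of two
    consecutive partial sums is then of order at least c_i. *)
Lemma partial_sum_lower_growth (d : measure_display) (T : measurableType d) (R : realType)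
    (P : probability T R) (X : nat -> {RV P >-> R}) (alpha b : R) :
  0 < alpha -> alpha < 1 -> iid X ->
  (\int[P]_w (log_moment alpha b `|X 0%N w|)%:E)%E = +oo%E ->
  {ae P, forall w, exists2 c, 0 < c & forall N, exists2 n, (N <= n)%N &
    c * (n%:R `^ alpha^-1 * ln n%:R `^ b) <= `|partial_sum X n w|}.
Proof.
move=> a0 a1 [indX idX] infty.
have [C C0 HC] := log_moment_le_count b a0 a1.
have [D D0 HD] := dyadic_norm_quasimono b a0 a1.
have [B B0 HB] := dyadic_norm_comparable b a0.
have I1 : (\int[P]_w 1 = 1)%E by rewrite integral_cst// mul1e; exact: probability_setT.
pose c i := dyadic_norm alpha b (trunc_log 2 i).
have c0 i : 0 < c i by exact: dyadic_norm_gt0.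
pose A i := [set x : R | c i <= `|x|].
have mA i : measurable (A i).
  rewrite (_ : A i = (fun x : R => `|x|) @^-1` `[c i, +oo[%classic); last first.
    by apply/seteqP; split => x /=; rewrite in_itv/= andbT.
  by rewrite -[_ @^-1` _]setTI; apply: normr_measurable.
have mphi : measurable_fun [set: T] (fun w => (log_moment alpha b `|X 0%N w|)%:E).
  by apply/measurable_EFinP; apply: (measurableT_comp (measurable_log_moment alpha b));
    exact: measurable_funPT.
have mXA i j : measurable (X j @^-1` A i) by exact: measurable_preimage_RV.
have : {ae P, forall w, forall N, exists2 i, (N <= i)%N & A i (X i w)}.
  apply: second_borel_cantelli => //.
  under eq_eseriesr do rewrite [P _](idX _ 0%N _ (mA _)).
  apply/eqP; rewrite -leye_eq leNgt; apply/negP => fin.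
  suff : (\int[P]_w (log_moment alpha b `|X 0%N w|)%:E < +oo)%E by rewrite infty.
  apply: (@le_lt_trans _ _ (\int[P]_w (C%:E * (1 + \sum_(i <oo) (\1_(X 0%N @^-1` A i) w)%:E)))%E).
    apply: ge0_le_integral => //.
    - by move=> w _; rewrite lee_fin log_moment_ge0.
    - apply: emeasurable_funM => //; apply: emeasurable_funD => //.
      apply: ge0_emeasurable_sum => // i _; apply/measurable_EFinP; exact: measurable_indic.
    move=> w _; have [n hn] := HC `|X 0%N w| (normr_ge0 _).
    apply: (@le_trans _ _
      (C%:E * (1 + \sum_(0 <= i < n) (\1_(X 0%N @^-1` A i) w)%:E)))%E; last first.
      rewrite lee_pmul2l ?lte_fin// leeD2l//.
      apply: nneseries_lim_ge => i _ _; by rewrite lee_fin.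
    rewrite sumEFin -EFinD -EFinM lee_fin (le_trans hn)// ler_pM2l// lerD2l.
    have E i : (c i <= `|X 0%N w|)%R%:R = \1_(X 0%N @^-1` A i) w :> R.
      by rewrite indicE; congr (_%:R); congr nat_of_bool; apply/idP/idP; rewrite inE.
    under eq_bigr do rewrite E.
    case: n {hn} => [|n]; first by rewrite !big_geq.
    by rewrite [leRHS]big_ltn// lerDr.
  rewrite ge0_integralZl ?lee_fin ?(ltW C0)//; last 2 first.
  - apply: emeasurable_funD => //.
    apply: ge0_emeasurable_sum => // i _; apply/measurable_EFinP; exact: measurable_indic.
  - by move=> w _; rewrite adde_ge0// nneseries_ge0.
  rewrite ge0_integralD//; last 2 first.
  - by move=> w _; rewrite nneseries_ge0.
  - apply: ge0_emeasurable_sum => // i _; apply/measurable_EFinP; exact: measurable_indic.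
  rewrite I1 integral_nneseries//; last first.
    by move=> i; apply/measurable_EFinP; exact: measurable_indic.
  under eq_eseriesr do rewrite integral_indic// setIT.
  rewrite lte_mul_pinfty// ?lee_fin ?(ltW C0)//.
  by apply: lte_add_pinfty => //; exact: ltry.
apply: filterS => w hw.
exists (2 * D * B)^-1; first by rewrite invr_gt0 !mulr_gt0.
move=> N.
have D1 : 1 <= D by rewrite -(ler_pM2r (c0 0%N)) mul1r HD.
have key n : (1 < n)%N -> c n <= 2 * D * `|partial_sum X n w| ->
    (2 * D * B)^-1 * (n%:R `^ alpha^-1 * ln n%:R `^ b) <= `|partial_sum X n w|.
  move=> n1 h; have [_ hB] := HB n n1.
  rewrite mulrC ler_pdivrMr ?mulr_gt0//; apply: (le_trans hB).
  by rewrite (_ : _ * (2 * D * B) = B * (2 * D * `|partial_sum X n w|)); [rewrite ler_pM2l|ring].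
(* The shift by 3 leaves both i and i + 1 above 1 and N. *)
have [[|i] Ni hi] := hw N.+3; first by [].
have SE : X i.+1 w = partial_sum X i.+1 w - partial_sum X i w.
  by rewrite /partial_sum (@big_nat_recr _ _ _ i.+1)//= addrC addrK.
have tri : c i.+1 <= `|partial_sum X i.+1 w| + `|partial_sum X i w|.
  by apply: (le_trans hi); rewrite SE ler_normB.
have S0 := normr_ge0 (partial_sum X i.+1 w); have S1 := normr_ge0 (partial_sum X i w).
have [h|h] := leP (c i.+1) (2 * `|partial_sum X i.+1 w|).
  exists i.+1; first by lia.
  by apply: key; [lia|nra].
exists i; first by lia.
apply: key; first by lia.
apply: (le_trans (HD i i.+1 (leqnSn i))).
rewrite [2 * D]mulrC -mulrA ler_pM2l// -/(c i.+1); lra.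
Qed.

(** * The logarithmic growth exponent *)

(* [X 0] is the generic variable X, and [X n] is X_n for n >= 1.  The limsup
   does not depend on the terms n < 3, where [ln (ln n)] is not positive. *)
Theorem theorem2p5 (R : realType) (alpha beta : R)
    (halpha0 : 0 < alpha) (halpha1 : alpha < 1)
    (d : measure_display) (T : measurableType d) (P : probability T R)
    (X : nat -> {RV P >-> R}) (hX : iid X) :
  {ae P, forall w,
    limn_esup (fun n : nat =>
      (`| partial_sum X n w / n%:R `^ (alpha^-1) | `^ ((ln (ln n%:R))^-1))%:E)
    = (expR beta)%:E}
  <->
  ereal_inf [set b%:E | b in
    [set b : R |
      ('E_P[ (fun w => (`|X 0%N w| `^ alpha / logL `|X 0%N w| `^ (b * alpha))%R) ]
        < +oo)%E]] = beta%:E.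
Proof.
pose L w := limn_esup (fun n : nat =>
  (`| partial_sum X n w / n%:R `^ (alpha^-1) | `^ ((ln (ln n%:R))^-1))%:E).
set S := [set b : R | _].
have SE b : S b = (\int[P]_w (log_moment alpha b `|X 0%N w|)%:E < +oo)%E :> Prop.
  by rewrite /S /= unlock.
have up b : S b -> {ae P, forall w, (L w <= (expR b)%:E)%E}.
  rewrite SE => fin; have := partial_sum_upper_growth halpha0 halpha1 hX.2 fin.
  by apply: filterS => w [M hM]; exact: limn_esup_lnln_root_le hM.
have lo b : ~ S b -> {ae P, forall w, ((expR b)%:E <= L w)%E}.
  rewrite SE => /negP; rewrite -leNgt leye_eq => /eqP infty.
  have := partial_sum_lower_growth halpha0 halpha1 hX infty.
  by apply: filterS => w [c c0 hc]; exact: limn_esup_lnln_root_ge c0 hc.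
rewrite -[X in X <-> _]/({ae P, forall w, L w = (expR beta)%:E}).
split=> [hL | hS].
  have PT : (0 < P [set: T])%E by rewrite [P _](probability_setT P).
  have PF := ae_properfilter_algebraOfSetsType PT.
  have le_beta b : S b -> beta <= b.
    move=> /up h; have [w [Lw]] := @filter_ex _ _ PF _ (filterI hL h).
    by rewrite Lw lee_fin ler_expR.
  have ge_beta b : ~ S b -> b <= beta.
    move=> /lo h; have [w [Lw]] := @filter_ex _ _ PF _ (filterI hL h).
    by rewrite Lw lee_fin ler_expR.
  apply/eqP; rewrite eq_le; apply/andP; split.
    apply/lee_addgt0Pr => e e0; apply: ereal_inf_lbound; exists (beta + e) => //.
    by apply: contrapT => /ge_beta; rewrite gerDl leNgt e0.
  by apply: le_ereal_inf_tmp => _ [b /le_beta Sb <-]; rewrite lee_fin.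
have upk k : {ae P, forall w, (L w <= (expR (beta + k.+1%:R^-1))%:E)%E}.
  have : (ereal_inf [set b%:E | b in S] < (beta + k.+1%:R^-1)%:E)%E.
    by rewrite hS lte_fin ltrDl invr_gt0.
  move=> /ereal_inf_lt[_ [b Sb <-]]; rewrite lte_fin => bk.
  apply: filterS (up b Sb) => w /le_trans; apply.
  by rewrite lee_fin ler_expR ltW.
have lok k : {ae P, forall w, ((expR (beta - k.+1%:R^-1))%:E <= L w)%E}.
  apply: lo => Sb.
  have : (beta%:E <= (beta - k.+1%:R^-1)%:E)%E.
    by rewrite -hS; apply: ereal_inf_lbound; exists (beta - k.+1%:R^-1).
  by rewrite lee_fin lerDl oppr_ge0 leNgt invr_gt0 ltr0n.
apply: (filterS _ (filterI (ae_foralln upk) (ae_foralln lok))) => w [h1 h2].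
have small (e : R) : 0 < e -> exists k, k.+1%:R^-1 <= e.
  move=> e0; exists (Num.bound e^-1).
  rewrite invf_ple ?posrE// ltW// (lt_trans (archi_boundP _))// ?ltr_nat//.
  by rewrite invr_ge0 ltW.
apply/eqP; rewrite eq_le; apply/andP; split.
  apply: lee_expR_addr => e /small[k ke]; apply: le_trans (h1 k) _.
  by rewrite lee_fin ler_expR lerD2l.
apply: lee_expR_subr => e /small[k ke]; apply: le_trans (h2 k).
by rewrite lee_fin ler_expR lerD2l lerN2.
Qed.
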